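(* For a semigroup $S$ the following conditions are equivalent: (1) $S$ is regular; (2) $A^C_{\beta\alpha}\circ B^C_{\beta\alpha}=A^C_{\beta\alpha}\cap B^C_{\beta\alpha}$ for any intuitionistic fuzzy right ideal $A=(\mu_A,\nu_A)$ and any intuitionistic fuzzy left ideal $B=(\mu_B,\nu_B)$ of $S$ (and every $\beta\in(0,1]$ and every $\alpha\ge0$ with $\alpha\le\inf_{x\in S}\beta\nu_A(x)$ and $\alpha\le\inf_{x\in S}\beta\nu_B(x)$).
   Context: A semigroup is a non-empty set with an associative binary operation. $S$ is regular if for each $a\in S$ there exists $x\in S$ with $a=axa$. An intuitionistic fuzzy subset of $S$ is a pair $A=(\mu_A,\nu_A)$ of functions $\mu_A,\nu_A:S\to[0,1]$ with $0\le\mu_A(x)+\nu_A(x)\le1$ for all $x\in S$; it is non-empty if it is not the empty one ($\mu_A\equiv0$, $\nu_A\equiv1$). For $\beta\in(0,1]$ and $\alpha\in[0,\inf_{x\in S}\beta\nu_A(x)]$, the intuitionistic fuzzy magnified translation of $A$ is $A^C_{\beta\alpha}=((\mu_A)^C_{\beta\alpha},(\nu_A)^C_{\beta\alpha})$ with $(\mu_A)^C_{\beta\alpha}(x)=\beta\mu_A(x)+\alpha$ and $(\nu_A)^C_{\beta\alpha}(x)=\beta\nu_A(x)-\alpha$ for all $x\in S$. A non-empty intuitionistic fuzzy subset $A$ of $S$ is an intuitionistic fuzzy left (resp. right) ideal if $\mu_A(xy)\ge\mu_A(y)$ and $\nu_A(xy)\le\nu_A(y)$ (resp. $\mu_A(xy)\ge\mu_A(x)$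 and $\nu_A(xy)\le\nu_A(x)$) for all $x,y\in S$. For intuitionistic fuzzy subsets $A,B$ of $S$: $A\cap B$ has membership function $x\mapsto\min\{\mu_A(x),\mu_B(x)\}$ and non-membership function $x\mapsto\max\{\nu_A(x),\nu_B(x)\}$. The product $A\circ B=(\mu_A\circ\mu_B,\nu_A\circ\nu_B)$ is given by $(\mu_A\circ\mu_B)(x)=\sup_{x=uv}\min\{\mu_A(u),\mu_B(v)\}$ and $(\nu_A\circ\nu_B)(x)=\inf_{x=uv}\max\{\nu_A(u),\nu_B(v)\}$ (over $u,v\in S$ with $x=uv$), with values $0$ and $1$ respectively if $x$ is not of the form $uv$ with $u,v\in S$. Equality means equality of both component functions. *)

(* Defs.v *)
From mathcomp Require Import all_boot all_order all_algebra.
From mathcomp Require Import boolp classical_sets reals.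

Set Implicit Arguments.
Unset Strict Implicit.
Unset Printing Implicit Defensive.

Import Order.TTheory GRing.Theory Num.Theory.
Local Open Scope classical_set_scope.
Local Open Scope ring_scope.

Definition regular_semigroup (S : semigroupType) : Prop :=
  forall a : S, exists x : S, a = (a * x * a)%g.

(* A pair (mu, nu) of real-valued functions, not yet constrained; the
   constraints are the predicate [if_subset]. Equality of such pairs is
   equality of both component functions. *)
Record if_pair (S : Type) (R : realType) := IFPair {
  mu : S -> R;
  nu : S -> R
}.

Section Subsets.
Variables (S : Type) (R : realType).
Implicit Types A B : if_pair S R.

Definition if_subset A : Prop := forall x : S,
  [/\ 0 <= mu A x <= 1, 0 <= nu A x <= 1 & 0 <= mu A x + nu A x <= 1].

Definition if_empty : if_pair S R := IFPair (fun=> 0) (fun=> 1).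

Definition if_cap A B : if_pair S R :=
  IFPair (fun x => Num.min (mu A x) (mu B x))
         (fun x => Num.max (nu A x) (nu B x)).

Definition magnified_translation (beta alpha : R) A : if_pair S R :=
  IFPair (fun x => beta * mu A x + alpha) (fun x => beta * nu A x - alpha).

Definition translation_bound (beta : R) A : R :=
  inf [set beta * nu A x | x in [set: S]].

End Subsets.

Section Ideals.
Variables (S : semigroupType) (R : realType).
Implicit Types A B : if_pair S R.

Definition if_left_ideal A : Prop :=
  [/\ if_subset A, A <> @if_empty S R &
      forall x y : S,
        (mu A y <= mu A (x * y)%g) /\ (nu A (x * y)%g <= nu A y)].

Definition if_right_ideal A : Prop :=
  [/\ if_subset A, A <> @if_empty S R &
      forall x y : S,
        (mu A x <= mu A (x * y)%g) /\ (nu A (x * y)%g <= nu A x)].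

Definition factorizations (x : S) : set (S * S) :=
  [set uv | x = (uv.1 * uv.2)%g].

(* The case distinction is needed because [inf set0 = 0] in the library. *)
Definition if_prod A B : if_pair S R :=
  IFPair
    (fun x => if `[< factorizations x !=set0 >]
              then sup [set Num.min (mu A uv.1) (mu B uv.2)
                       | uv in factorizations x]
              else 0)
    (fun x => if `[< factorizations x !=set0 >]
              then inf [set Num.max (nu A uv.1) (nu B uv.2)
                       | uv in factorizations x]
              else 1).

End Ideals.

Arguments if_empty {S R}.

(* Main.v *)
(** Translating by [beta], [alpha] preserves the ideal inequalities. If
    [x = x y x], the factorization [x = (x y) x] attains the extremum defining
    the product, and the ideal inequalities make every other factorization no
    better. Conversely, taking the characteristic pairs of the principal right
    ideal [a S^1] and the principal left ideal [S^1 a], with [beta = 1] and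
    [alpha = 0], the equality at [a] puts [a] in [(a S^1) (S^1 a)], so that [a]
    is [a a] or [a s a]. *)

Require Import Defs.
From mathcomp Require Import all_boot all_order all_algebra.
From mathcomp Require Import boolp classical_sets reals.
Import Order.TTheory GRing.Theory Num.Theory.
Local Open Scope classical_set_scope.
Local Open Scope ring_scope.

(** The maximum [m] itself witnesses both that [E] is non-empty and that it is bounded above. *)
Lemma sup_attained (R : realType) (E : set R) (m : R) :
  E m -> ubound E m -> sup E = m.
Proof.
move=> Em Em_ub; apply/le_anti/andP; split.
  by apply: ge_sup => //; exists m.
by apply: ub_le_sup => //; exists m.
Qed.

Lemma inf_attained (R : realType) (E : set R) (m : R) :
  E m -> lbound E m -> inf E = m.
Proof.
move=> Em Em_lb; apply/le_anti/andP; split.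
  by apply: ge_inf => //; exists m.
by apply: lb_le_inf => //; exists m.
Qed.

Section Product.
Context {S : semigroupType} {R : realType}.
Implicit Types A B : if_pair S R.

Lemma if_prod_regular A B : regular_semigroup S ->
  (forall x y : S, mu A x <= mu A (x * y)%g /\ nu A (x * y)%g <= nu A x) ->
  (forall x y : S, mu B y <= mu B (x * y)%g /\ nu B (x * y)%g <= nu B y) ->
  if_prod A B = if_cap A B.
Proof.
move=> regS idA idB; congr IFPair; apply: funext => x;
  have [y xyx] := regS x; have F : factorizations x ((x * y)%g, x) by [];
  (* Going from [x] to [x * y] and on to [x * y * x = x] closes a cycle of inequalities, so [A]
     takes the same values at [x * y] and at [x]. *)
  have [muA nuA] := idA x y; have := idA (x * y)%g x;
  rewrite -xyx => -[muA' nuA'];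
  rewrite asboolT; try by exists ((x * y)%g, x).
- apply: sup_attained.
    exists ((x * y)%g, x) => //=; congr Num.min.
    by apply/le_anti; rewrite muA muA'.
  move=> _ [[u v] /= -> <-].
  by rewrite le_min !ge_min (idA u v).1 (idB u v).1 orbT.
- apply: inf_attained.
    exists ((x * y)%g, x) => //=; congr Num.max.
    by apply/le_anti; rewrite nuA nuA'.
  move=> _ [[u v] /= -> <-].
  by rewrite ge_max !le_max (idA u v).2 (idB u v).2 orbT.
Qed.

Lemma magnified_translation10 A : magnified_translation 1 0 A = A.
Proof.
by case: A => m n; congr IFPair; apply: funext => x /=;
  rewrite mul1r ?addr0 ?subr0.
Qed.

(** This makes [alpha = 0] an admissible choice in the converse direction. *)
Lemma translation_bound_ge0 (beta : R) A : [set: S] !=set0 -> 0 <= beta ->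
  if_subset A -> 0 <= translation_bound beta A.
Proof.
move=> [x _] beta0 subA; apply: lb_le_inf; first by exists (beta * nu A x), x.
by move=> _ [y _ <-]; have [_ /andP[nu0 _] _] := subA y; apply: mulr_ge0.
Qed.

Definition if_char (P : set S) : if_pair S R :=
  IFPair (fun x => (`[< P x >])%:R) (fun x => (~~ `[< P x >])%:R).

Lemma if_char_subset (P : set S) : if_subset (if_char P).
Proof.
by move=> x /=; case: asboolP => _ /=; split;
  rewrite ?addr0 ?add0r ?ler01 ?lexx.
Qed.

Lemma if_char_neq_empty (P : set S) : P !=set0 -> if_char P <> if_empty.
Proof.
move=> [x Px] /(congr1 (fun A => mu A x)) /= /eqP.
by rewrite asboolT // oner_eq0.
Qed.

Lemma if_char_le (P : set S) (x y : S) : (P x -> P y) ->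
  mu (if_char P) x <= mu (if_char P) y /\ nu (if_char P) y <= nu (if_char P) x.
Proof.
move=> PP /=; rewrite !ler_nat; case: asboolP => [/PP Py|_].
  by rewrite asboolT.
by split => //; exact: leq_b1.
Qed.

Lemma if_char_right_ideal (P : set S) : P !=set0 ->
  (forall x y : S, P x -> P (x * y)%g) -> if_right_ideal (if_char P).
Proof.
move=> P0 PM; split; [exact: if_char_subset | exact: if_char_neq_empty |].
by move=> x y; apply/if_char_le/PM.
Qed.

Lemma if_char_left_ideal (P : set S) : P !=set0 ->
  (forall x y : S, P y -> P (x * y)%g) -> if_left_ideal (if_char P).
Proof.
move=> P0 PM; split; [exact: if_char_subset | exact: if_char_neq_empty |].
by move=> x y; apply/if_char_le/PM.
Qed.

(** If every factorization had a factor outside its set, all the minima would be 0, and so would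
    their supremum. *)
Lemma if_prod_char_gt0 (P Q : set S) (x : S) :
  0 < mu (if_prod (if_char P) (if_char Q)) x ->
  exists u v : S, [/\ x = (u * v)%g, P u & Q v].
Proof.
(* Without factorizations the value is the default 0, which is not positive. *)
rewrite /=; case: asboolP => [[f xf]|_]; last by rewrite ltxx.
move=> sup_gt0; apply: contrapT => noPQ; move: sup_gt0; apply/negP.
rewrite -leNgt; apply: ge_sup; first by eexists; exists f.
move=> _ [[u v] /= xuv <-]; rewrite ge_min.
case: asboolP => [Pu|_]; last by rewrite lexx.
case: asboolP => [Qv|_]; last by rewrite lexx orbT.
by case: noPQ; exists u, v.
Qed.

(** A semigroup may lack an identity, so the first disjunct puts [a] itself into [a S^1]. *)
Definition principal_right (a : S) : set S :=
  [set x | x = a \/ exists s, x = (a * s)%g].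

Definition principal_left (a : S) : set S :=
  [set x | x = a \/ exists s, x = (s * a)%g].

Lemma principal_rightM (a x y : S) :
  principal_right a x -> principal_right a (x * y)%g.
Proof.
by move=> [->|[s ->]]; right; [exists y | exists (s * y)%g; rewrite mulgA].
Qed.

Lemma principal_leftM (a x y : S) :
  principal_left a y -> principal_left a (x * y)%g.
Proof.
by move=> [->|[s ->]]; right; [exists x | exists (x * s)%g; rewrite mulgA].
Qed.

Lemma principal_regular (a u v : S) : a = (u * v)%g ->
  principal_right a u -> principal_left a v -> exists x, a = (a * x * a)%g.
Proof.
move=> auv Ru Lv; move: auv.
case: Ru => [->|[s ->]]; case: Lv => [->|[t ->]] auv.
(* Here [a = a * a], hence [a * a * a = a]; in the other cases the witness is what stands between
   the outer two copies of [a]. *)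
- by exists a; rewrite -auv.
- by exists t; rewrite -mulgA.
- by exists s.
- by exists (s * t)%g; rewrite {1}auv !mulgA.
Qed.

End Product.

Theorem theorem3p32 (R : realType) (S : semigroupType)
    (S_neq0 : [set: S] !=set0) :
  regular_semigroup S <->
  (forall A B : if_pair S R, if_right_ideal A -> if_left_ideal B ->
   forall beta alpha : R, 0 < beta <= 1 -> 0 <= alpha ->
     alpha <= translation_bound beta A ->
     alpha <= translation_bound beta B ->
     if_prod (magnified_translation beta alpha A)
             (magnified_translation beta alpha B) =
     if_cap (magnified_translation beta alpha A)
            (magnified_translation beta alpha B)).
Proof.
split=> [regS A B [_ _ idA] [_ _ idB] beta alpha /andP[beta0 _] _ _ _|prodE a].
  (* As [beta] is positive, the translated inequalities cancel down to the original ones. *)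
  apply: if_prod_regular => // x y /=; rewrite !lerD2r !ler_pM2l //.
have Ra : principal_right a a by left.
have La : principal_left a a by left.
set A := if_char (R := R) (principal_right a).
set B := if_char (R := R) (principal_left a).
have idA : if_right_ideal A.
  by apply: if_char_right_ideal; [exists a | exact: principal_rightM].
have idB : if_left_ideal B.
  by apply: if_char_left_ideal; [exists a | exact: principal_leftM].
have := prodE A B idA idB 1 0.
rewrite !magnified_translation10 ltr01 !lexx.
move=> /(_ isT isT) AB.
have {}AB : if_prod A B = if_cap A B.
  by apply: AB; apply: translation_bound_ge0 => //; apply: if_char_subset.
(* Both membership functions equal 1 at [a], so the intersection, and with it the product, has the
   positive value 1 there. *)
have [|u [v [auv Ru Lv]]] :=
  @if_prod_char_gt0 S R (principal_right a) (principal_left a) a.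
  by rewrite -/A -/B AB /= !asboolT // minxx ltr01.
exact: principal_regular auv Ru Lv.
Qed.
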